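(* Let $\mathcal{P}$ be a linear transformation of the split semi-quaternion algebra $\mathbb{H}_{ss}$ with matrix $P$ with respect to the basis $e_0,e_1,e_2,e_3$. Then $\mathcal{P}$ is a Rota-Baxter operator of weight $0$ on $\mathbb{H}_{ss}$ if and only if $P$ is one of the following matrices, where $a,b,c,d$ are real parameters (such that all denominators occurring in the matrix are nonzero): $$\begin{pmatrix}0&0&0&0\\0&0&0&0\\ a&b&0&0\\ c&d&0&0\end{pmatrix},\quad\begin{pmatrix}0&0&0&0\\0&0&0&0\\ a&b&c&-c\\ a&b&c&-c\end{pmatrix},\quad\begin{pmatrix}0&0&0&0\\0&0&0&0\\ a&b&c&c\\-a&-b&-c&-c\end{pmatrix},$$ $$\begin{pmatrix}0&0&a&-a\\0&0&-a&a\\0&0&b&-b\\0&0&b&-b\end{pmatrix},\quad\begin{pmatrix}0&0&a&-a\\0&0&a&-a\\0&0&b&-b\\0&0&b&-b\end{pmatrix},\quad\begin{pmatrix}0&0&a&a\\0&0&-a&-a\\0&0&b&b\\0&0&-b&-b\end{pmatrix},$$ $$\begin{pmatrix}0&0&a&a\\0&0&a&a\\0&0&b&b\\0&0&-b&-b\end{pmatrix},\quad\begin{pmatrix}0&a&b&-b\\0&-a&-b&b\\0&c&\frac{bc}{a}&-\frac{bc}{a}\\0&c-\frac{a^2}{b}&\frac{bc}{a}-a&a-\frac{bc}{a}\end{pmatrix},$$ $$\begin{pmatrix}0&a&b&-b\\0&a&b&-b\\0&c&\frac{bc}{a}&-\frac{bc}{a}\\0&\frac{a^2}{b}+c&\frac{bc}{a}+a&-\frac{a^2+bc}{a}\end{pmatrix},\quad\begin{pmatrix}0&a&b&b\\0&-a&-b&-b\\0&c&\frac{bc}{a}&\frac{bc}{a}\\0&\frac{a^2}{b}-c&a-\frac{bc}{a}&a-\frac{bc}{a}\end{pmatrix},$$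 $$\begin{pmatrix}0&a&b&b\\0&a&b&b\\0&c&\frac{bc}{a}&\frac{bc}{a}\\0&-\frac{a^2+bc}{b}&-\frac{a^2+bc}{a}&-\frac{a^2+bc}{a}\end{pmatrix}.$$
   Context: All algebras are over $\mathbb{R}$ and linear means $\mathbb{R}$-linear. The split semi-quaternion algebra $\mathbb{H}_{ss}$ is the 4-dimensional associative unital $\mathbb{R}$-algebra with basis $e_0=1,e_1,e_2,e_3$ and multiplication $e_1^2=1$, $e_2^2=0$, $e_3^2=0$, $e_1e_2=e_3=-e_2e_1$, $e_2e_3=0=e_3e_2$, $e_3e_1=-e_2=-e_1e_3$. A Rota-Baxter operator of weight $\lambda\in\mathbb{R}$ on an algebra $A$ is a linear map $\mathcal{P}:A\to A$ with $\mathcal{P}(x)\mathcal{P}(y)=\mathcal{P}(\mathcal{P}(x)y)+\mathcal{P}(x\mathcal{P}(y))+\lambda\mathcal{P}(xy)$ for all $x,y\in A$. The matrix $P=(\gamma_0,\gamma_1,\gamma_2,\gamma_3)$ of $\mathcal{P}$ has as columns the coordinate vectors of $\mathcal{P}(e_0),\mathcal{P}(e_1),\mathcal{P}(e_2),\mathcal{P}(e_3)$, i.e. $\mathcal{P}(e_i)=(e_0,e_1,e_2,e_3)\gamma_i$. *)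

(* Defs.v *)
From HB Require Import structures.
From mathcomp Require Import all_boot all_order all_algebra.
From mathcomp Require Import ring.
From mathcomp Require Import reals.

Set Implicit Arguments.
Unset Strict Implicit.
Unset Printing Implicit Defensive.

Import GRing.Theory.
Local Open Scope ring_scope.

(* An element of the split semi-quaternion algebra is the column of its
   coordinates in the basis e_0 = 1, e_1, e_2, e_3. *)
Definition hss (R : realType) : Type := 'cV[R]_4.

HB.instance Definition _ (R : realType) := Vector.copy (hss R) 'cV[R]_4.

Section SplitSemiQuaternions.
Variable R : realType.
Implicit Types x y z : hss R.

Definition hss_coord x (i : 'I_4) : R := (x : 'cV[R]_4) i 0.

Definition hss_basis (i : 'I_4) : hss R := delta_mx i 0.

Local Notation e k := (hss_basis (inord k)).

Definition hss_mk (a b c d : R) : hss R :=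
  \col_(i < 4) [:: a; b; c; d]`_i.

(* The bilinear extension of the multiplication table of the e_i; the table
   itself is recovered in hss_table and hss_basis0. *)
Definition hss_mul x y : hss R :=
  let x0 := hss_coord x (inord 0) in let x1 := hss_coord x (inord 1) in
  let x2 := hss_coord x (inord 2) in let x3 := hss_coord x (inord 3) in
  let y0 := hss_coord y (inord 0) in let y1 := hss_coord y (inord 1) in
  let y2 := hss_coord y (inord 2) in let y3 := hss_coord y (inord 3) in
  hss_mk (x0 * y0 + x1 * y1)
         (x0 * y1 + x1 * y0)
         (x0 * y2 + x2 * y0 + x1 * y3 - x3 * y1)
         (x0 * y3 + x3 * y0 + x1 * y2 - x2 * y1).

Definition hss_one : hss R := hss_basis ord0.

Lemma hss_eqP x y :
  (forall k, (k < 4)%N -> hss_coord x (inord k) = hss_coord y (inord k)) ->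
  x = y.
Proof.
move=> h; apply/matrixP => i j; rewrite (ord1 j) -(inord_val i).
exact: h.
Qed.

Lemma hss_coord_mk a b c d k : (k < 4)%N ->
  hss_coord (hss_mk a b c d) (inord k) = [:: a; b; c; d]`_k.
Proof. by move=> hk; rewrite /hss_coord mxE inordK. Qed.

Lemma hss_coordD x y i : hss_coord (x + y) i = hss_coord x i + hss_coord y i.
Proof. exact: mxE. Qed.

Lemma hss_coordZ (a : R) x i : hss_coord (a *: x) i = a * hss_coord x i.
Proof. exact: mxE. Qed.

Lemma hss_coordN x i : hss_coord (- x) i = - hss_coord x i.
Proof. exact: mxE. Qed.

Lemma hss_coord0 i : hss_coord 0 i = 0.
Proof. exact: mxE. Qed.

Lemma hss_coord_basis i j : hss_coord (hss_basis j) i = (i == j)%:R.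
Proof. by rewrite /hss_coord /hss_basis mxE eqxx andbT. Qed.

Lemma hss_coord_basis_nat k l : (k < 4)%N -> (l < 4)%N ->
  hss_coord (e l) (inord k) = (k == l)%:R.
Proof. by move=> hk hl; rewrite hss_coord_basis -val_eqE /= !inordK. Qed.

Lemma hss_coord_one k : (k < 4)%N ->
  hss_coord hss_one (inord k) = (k == 0)%:R.
Proof. by move=> hk; rewrite hss_coord_basis -val_eqE /= inordK. Qed.

Let hssE := (hss_coord_mk, hss_coordD, hss_coordZ, hss_coordN, hss_coord0,
             hss_coord_basis_nat, hss_coord_one).

Lemma hss_mulA : associative hss_mul.
Proof.
by move=> x y z; apply: hss_eqP => -[|[|[|[|//]]]] _;
   rewrite /hss_mul !hssE //=; ring.
Qed.

Lemma hss_mul1x : left_id hss_one hss_mul.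
Proof.
by move=> x; apply: hss_eqP => -[|[|[|[|//]]]] _;
   rewrite /hss_mul !hssE //=; ring.
Qed.

Lemma hss_mulx1 : right_id hss_one hss_mul.
Proof.
by move=> x; apply: hss_eqP => -[|[|[|[|//]]]] _;
   rewrite /hss_mul !hssE //=; ring.
Qed.

Lemma hss_mulDl : left_distributive hss_mul +%R.
Proof.
by move=> x y z; apply: hss_eqP => -[|[|[|[|//]]]] _;
   rewrite /hss_mul !hssE //=; ring.
Qed.

Lemma hss_mulDr : right_distributive hss_mul +%R.
Proof.
by move=> x y z; apply: hss_eqP => -[|[|[|[|//]]]] _;
   rewrite /hss_mul !hssE //=; ring.
Qed.

Lemma hss_one_neq0 : hss_one != 0.
Proof.
apply/eqP => /(congr1 (fun x => hss_coord x (inord 0))).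
by rewrite !hssE //= => /eqP; rewrite oner_eq0.
Qed.

HB.instance Definition _ := GRing.Zmodule_isNzRing.Build (hss R)
  hss_mulA hss_mul1x hss_mulx1 hss_mulDl hss_mulDr hss_one_neq0.

Lemma hss_scaleAl (a : R) x y : a *: (x * y) = (a *: x) * y.
Proof.
by apply: hss_eqP => -[|[|[|[|//]]]] _;
   rewrite /GRing.mul /= /hss_mul !hssE //=; ring.
Qed.

Lemma hss_scaleAr (a : R) x y : a *: (x * y) = x * (a *: y).
Proof.
by apply: hss_eqP => -[|[|[|[|//]]]] _;
   rewrite /GRing.mul /= /hss_mul !hssE //=; ring.
Qed.

HB.instance Definition _ :=
  GRing.Lmodule_isLalgebra.Build R (hss R) hss_scaleAl.
HB.instance Definition _ :=
  GRing.Lalgebra_isAlgebra.Build R (hss R) hss_scaleAr.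

Lemma hss_basis0 : e 0 = 1.
Proof. by rewrite (_ : inord 0 = ord0) //; apply: val_inj; rewrite /= inordK. Qed.

Lemma hss_table :
  [/\ [/\ e 1 * e 1 = 1, e 2 * e 2 = 0 & e 3 * e 3 = 0],
      [/\ e 1 * e 2 = e 3 & e 2 * e 1 = - e 3],
      [/\ e 2 * e 3 = 0 & e 3 * e 2 = 0] &
      [/\ e 3 * e 1 = - e 2 & e 1 * e 3 = e 2]].
Proof.
rewrite -hss_basis0.
by split; split; apply: hss_eqP => -[|[|[|[|//]]]] _;
   rewrite /GRing.mul /= /hss_mul !hssE //=; ring.
Qed.

Lemma hss_sum_basis x : x = \sum_(i < 4) hss_coord x i *: hss_basis i.
Proof.
rewrite {1}[x]matrix_sum_delta; apply: eq_bigr => i _.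
by rewrite big_ord1.
Qed.

(* The j-th column holds the coordinates of P e_j. *)
Definition hss_matrix (P : {linear hss R -> hss R}) : 'M[R]_4 :=
  \matrix_(i < 4, j < 4) hss_coord (P (hss_basis j)) i.

Lemma hss_matrixE (P : {linear hss R -> hss R}) j :
  P (hss_basis j) = \sum_(i < 4) hss_matrix P i j *: hss_basis i.
Proof.
rewrite {1}[P _]hss_sum_basis; apply: eq_bigr => i _.
by rewrite /hss_matrix mxE.
Qed.

End SplitSemiQuaternions.

Definition rota_baxter (R : realType) (A : algType R) (lambda : R)
    (P : {linear A -> A}) : Prop :=
  forall x y : A,
    P x * P y = P (P x * y) + P (x * P y) + lambda *: P (x * y).

Definition mx4 (R : realType) (s : seq (seq R)) : 'M[R]_4 :=
  \matrix_(i < 4, j < 4) (nth [::] s i)`_j.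

(* Main.v *)
(* The algebra is the sum of R f + R g, with f and g the orthogonal idempotents
   (1 + e_1) / 2 and (1 - e_1) / 2, and of the square-zero ideal N spanned by
   u = e_2 + e_3 and v = e_2 - e_3, where f u = u = u g, g v = v = v f and all
   other products of an idempotent with u or v vanish.  Comparing the f and g
   components in the Rota-Baxter identity on N shows that at most one of the
   four components of P u and P v along f and g is nonzero.  If one is, say that
   of P u along f, then P u is proportional to an idempotent and the remaining
   identities force P v = 0 and P f = - P g in the line of P u: P has rank one.
   The three other possibilities reduce to this one by the automorphism
   e_1 -> - e_1, e_3 -> - e_3 and the anti-automorphism exchanging u and v.  If
   none is, P induces a weight zero Rota-Baxter operator on R f + R g, which is
   zero, so P maps the algebra into N and acts nilpotently on N. *)

Require Import Defs.
From HB Require Import structures.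
From mathcomp Require Import all_boot all_order all_algebra.
From mathcomp Require Import reals ring lra.

Set Implicit Arguments.
Unset Strict Implicit.
Unset Printing Implicit Defensive.

Import GRing.Theory Num.Theory.
Local Open Scope ring_scope.

Local Notation "x @ k" := (hss_coord x (inord k)) (at level 2, format "x @ k").

(** * The weight zero identity in coordinates along f, g, u, v *)

Section PeirceCoordinates.
Variable F : realFieldType.
Implicit Types x y : nat -> F.

(* Coordinates 0, 1, 2, 3 are along f, g, u, v. *)
Definition peirce_mul x y (k : nat) : F :=
  match k with
  | 0 => x 0 * y 0
  | 1 => x 1 * y 1
  | 2 => x 0 * y 2 + x 2 * y 1
  | _ => x 1 * y 3 + x 3 * y 0
  end.

Variable q : nat -> nat -> F.

Definition mxapply x k := q k 0 * x 0 + q k 1 * x 1 + q k 2 * x 2 + q k 3 * x 3.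

Definition peirce_rota_baxter := forall x y k, (k < 4)%N ->
  peirce_mul (mxapply x) (mxapply y) k =
  mxapply (fun l => peirce_mul (mxapply x) y l + peirce_mul x (mxapply y) l) k.

Hypothesis rb : peirce_rota_baxter.

Let delta (i k : nat) : F := (k == i)%:R.

Let rb_at i j k := peirce_mul (mxapply (delta i)) (mxapply (delta j)) k =
  mxapply (fun l => peirce_mul (mxapply (delta i)) (delta j) l
                    + peirce_mul (delta i) (mxapply (delta j)) l) k.

Let rb_basis i j : [/\ rb_at i j 0, rb_at i j 1, rb_at i j 2 & rb_at i j 3].
Proof. by split; apply: rb. Qed.

Ltac expand := rewrite /rb_at /mxapply /peirce_mul /delta /=.

(** The f component at [(u, u)] gives [q 0 2 * q 1 2 = 0], so P u squares to [q 0 2] times itself.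
    Most other relations also arise from pairs containing u, by cancelling the factor [q 0 2]. The
    two quantified conjuncts mean P v = 0, P g = - P f, and P f in the line of P u. *)
Lemma peirce_rank_one : q 0 2 != 0 ->
  [/\ q 1 2 = 0, q 1 0 = 0, q 0 0 = - q 2 2,
      forall k, (k < 4)%N -> q k 3 = 0 /\ q k 1 = - q k 0 &
      forall k, (k < 4)%N -> q 0 2 * q k 0 = - q 2 2 * q k 2].
Proof.
move=> a0.
have q12 : q 1 2 = 0.
  by apply: (mulfI a0); have := rb_basis 2 2; expand => -[]; lra.
have q03 : q 0 3 = 0.
  by apply: (mulfI a0); have := rb_basis 3 2; expand; rewrite q12 => -[]; lra.
have q13 : q 1 3 = 0.
  by apply: (mulfI a0); have := rb_basis 2 3; expand;
     rewrite q12 q03 => -[]; lra.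
have q23 : q 2 3 = 0.
  by apply: (mulfI a0); have := rb_basis 2 3; expand;
     rewrite q12 q13 q03 => -[]; lra.
(* By now P v is [q 3 3] times v, and the v component at [(v, f)] reads
   [q 3 3 * q 0 0 = (q 3 3 + q 0 0) * q 3 3]. *)
have q33 : q 3 3 = 0.
  apply/eqP; rewrite -sqrf_eq0; apply/eqP.
  by have := rb_basis 3 0; expand; rewrite q13 q03 q23 => -[]; lra.
have q10 : q 1 0 = 0.
  by apply: (mulfI a0); have := rb_basis 0 2; expand; rewrite q12 => -[]; lra.
have q00 : q 0 0 = - q 2 2.
  by apply: (mulfI a0); have := rb_basis 0 2; expand; rewrite q12 => -[]; lra.
have q20 : q 0 2 * q 2 0 = - q 2 2 * q 2 2.
  by have := rb_basis 0 2; expand; rewrite q00 q12 => -[]; lra.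
have q30 : q 0 2 * q 3 0 = - q 2 2 * q 3 2.
  by have := rb_basis 2 0; expand; rewrite q00 q10 q12 q33 => -[]; lra.
have q11 : q 1 1 = 0.
  apply/eqP; rewrite -sqrf_eq0; apply/eqP.
  by have := rb_basis 1 1; expand; rewrite q12 q13 => -[]; lra.
have q01 : q 0 1 = q 2 2.
  by apply: (mulfI a0); have := rb_basis 2 1; expand;
     rewrite q11 q12 => -[]; lra.
have q21 : q 0 2 * q 2 1 = q 2 2 * q 2 2.
  by have := rb_basis 2 1; expand; rewrite q11 q12 => -[]; lra.
have q31 : q 0 2 * q 3 1 = q 2 2 * q 3 2.
  by have := rb_basis 1 2; expand; rewrite q11 q01 q12 q33 => -[]; lra.
have q21' : q 2 1 = - q 2 0 by apply: (mulfI a0); lra.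
have q31' : q 3 1 = - q 3 0 by apply: (mulfI a0); lra.
split=> // -[|[|[|[|//]]]] _; rewrite ?(q00, q01, q10, q11, q12) ?oppr0 ?opprK //.
  exact: mulrC.
by rewrite !mulr0.
Qed.

(** Modulo N the operator acts on a product of two fields, where the identity at [(f, f)] and
    [(g, g)] makes it vanish. Products in N being zero, the pairs [(f, f)], [(g, g)] and [(f, v)]
    then show that P kills P f, P g and P v. The conclusion encodes an image inside N and P^2 =
    0. *)
Lemma peirce_nilpotent : q 0 2 = 0 -> q 1 2 = 0 -> q 0 3 = 0 -> q 1 3 = 0 ->
  [/\ [/\ q 0 0 = 0, q 1 0 = 0, q 0 1 = 0 & q 1 1 = 0],
      q 2 2 = 0, q 3 3 = 0, q 2 3 = 0 \/ q 3 2 = 0 &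
      (q 2 3 != 0 -> q 3 0 = 0 /\ q 3 1 = 0) /\
      (q 3 2 != 0 -> q 2 0 = 0 /\ q 2 1 = 0)].
Proof.
move=> q02 q12 q03 q13.
have q00 : q 0 0 = 0.
  apply/eqP; rewrite -sqrf_eq0; apply/eqP.
  by have := rb_basis 0 0; expand; rewrite q02 q03 => -[]; lra.
have q11 : q 1 1 = 0.
  apply/eqP; rewrite -sqrf_eq0; apply/eqP.
  by have := rb_basis 1 1; expand; rewrite q12 q13 => -[]; lra.
have q10 : q 1 0 = 0.
  apply/eqP; rewrite -sqrf_eq0; apply/eqP.
  by have := rb_basis 0 0; expand; rewrite q00 q12 q13 => -[]; lra.
have q01 : q 0 1 = 0.
  apply/eqP; rewrite -sqrf_eq0; apply/eqP.
  by have := rb_basis 1 1; expand; rewrite q11 q02 q03 => -[]; lra.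
have q22 : q 2 2 = 0.
  apply/eqP; rewrite -sqrf_eq0; apply/eqP.
  by have := rb_basis 0 2; expand; rewrite q00 q02 q12 => -[]; lra.
have q33 : q 3 3 = 0.
  apply/eqP; rewrite -sqrf_eq0; apply/eqP.
  by have := rb_basis 3 0; expand; rewrite q00 q03 q13 => -[]; lra.
have q2332 : q 2 3 * q 3 2 = 0.
  by have := rb_basis 0 3; expand; rewrite q00 q10 q02 q12 q33 => -[]; lra.
split=> //.
  by move/eqP: q2332; rewrite mulf_eq0 => /orP[]/eqP; [left | right].
split=> nz.
  by split; apply: (mulfI nz); [have := rb_basis 0 0 | have := rb_basis 1 1];
     expand; rewrite q00 q10 q11 q01 q22 => -[]; lra.
by split; apply: (mulfI nz); [have := rb_basis 0 0 | have := rb_basis 1 1];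
   expand; rewrite q00 q10 q11 q01 q33 => -[]; lra.
Qed.
End PeirceCoordinates.

(** * Passage between the standard basis and the four signed Peirce bases *)

Section Coordinates.
Variables (R : realType) (P : {linear hss R -> hss R}).
Implicit Types x y : hss R.

Definition entry (k l : nat) : R := (P (hss_basis R (inord l)))@k.

Lemma hss_matrix_mx4 s :
  hss_matrix P = mx4 s <->
  forall k l, (k < 4)%N -> (l < 4)%N -> entry k l = (nth [::] s k)`_l.
Proof.
split=> [E k l hk hl | E].
  by have /matrixP/(_ (inord k) (inord l)) := E; rewrite !mxE !inordK.
apply/matrixP => i j; rewrite !mxE -E ?ltn_ord //.
by rewrite /entry !inord_val.
Qed.

Lemma coord_mul0 x y : (x * y)@0 = x@0 * y@0 + x@1 * y@1.
Proof. exact: hss_coord_mk. Qed.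
Lemma coord_mul1 x y : (x * y)@1 = x@0 * y@1 + x@1 * y@0.
Proof. exact: hss_coord_mk. Qed.
Lemma coord_mul2 x y : (x * y)@2 =
  x@0 * y@2 + x@2 * y@0 + x@1 * y@3 - x@3 * y@1.
Proof. exact: hss_coord_mk. Qed.
Lemma coord_mul3 x y : (x * y)@3 =
  x@0 * y@3 + x@3 * y@0 + x@1 * y@2 - x@2 * y@1.
Proof. exact: hss_coord_mk. Qed.

Lemma coord_lin x k : (P x)@k =
  entry k 0 * x@0 + entry k 1 * x@1 + entry k 2 * x@2 + entry k 3 * x@3.
Proof.
rewrite {1}[x]hss_sum_basis linear_sum /hss_coord summxE.
rewrite (eq_bigr (fun i : 'I_4 => entry (inord k : 'I_4) i * x i ord0)); last first.
  move=> i _; rewrite linearZ mxE mulrC /entry.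
  by rewrite !inord_val.
rewrite !big_ord_recl big_ord0 addr0 !addrA /entry !inord_val.
by do !congr (_ + _); congr (_ * x _ _); apply: val_inj; rewrite /= inordK.
Qed.

Definition coordE := (coord_mul0, coord_mul1, coord_mul2, coord_mul3, coord_lin,
  @hss_coordD R).

Local Notation p := entry.
Local Notation sg b := ((-1) ^+ b : R).

(* The signs s and t encode the four symmetries: f and u become
   (1 + t e_1) / 2 and (e_2 + s e_3) / 2.  For s <> t the multiplication in
   these coordinates is the opposite one, which has the same Rota-Baxter
   operators. *)
Definition peirce (s t : bool) x (k : nat) : R :=
  match k with
  | 0 => x@0 + sg t * x@1
  | 1 => x@0 - sg t * x@1
  | 2 => x@2 + sg s * x@3
  | _ => x@2 - sg s * x@3
  end.

Definition unpeirce (s t : bool) (v : nat -> R) : hss R :=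
  hss_mk ((v 0 + v 1) / 2) (sg t * (v 0 - v 1) / 2)
         ((v 2 + v 3) / 2) (sg s * (v 2 - v 3) / 2).

Lemma unpeirceK s t v k : (k < 4)%N -> peirce s t (unpeirce s t v) k = v k.
Proof.
by move: s t k => [] [] [|[|[|[|//]]]] _;
  rewrite /peirce /unpeirce !hss_coord_mk //= ?expr0 ?expr1; field.
Qed.

Lemma peirceM s t x y k : (k < 4)%N -> peirce s t (x * y) k =
  if s == t then peirce_mul (peirce s t x) (peirce s t y) k
  else peirce_mul (peirce s t y) (peirce s t x) k.
Proof.
by move: s t k => [] [] [|[|[|[|//]]]] _;
  rewrite /peirce /peirce_mul /= !coordE ?expr0 ?expr1; ring.
Qed.

Lemma peirceD s t x y k : peirce s t (x + y) k = peirce s t x k + peirce s t y k.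
Proof. by case: k => [|[|[|k]]] /=; rewrite !coordE; ring. Qed.

Definition peirce_mx s t k l : R :=
  peirce s t (P (unpeirce s t (fun i => (i == l)%:R))) k.

Lemma peirce_lin s t x k : (k < 4)%N ->
  peirce s t (P x) k = mxapply (peirce_mx s t) (peirce s t x) k.
Proof.
by move: s t k => [] [] [|[|[|[|//]]]] _;
  rewrite /mxapply /peirce_mx /peirce /unpeirce /= !coord_lin !hss_coord_mk //=
    ?expr0 ?expr1; field.
Qed.

Lemma peirce_rb s t : rota_baxter 0 P -> peirce_rota_baxter (peirce_mx s t).
Proof.
move=> rb x y k hk; set a := unpeirce s t x; set b := unpeirce s t y.
(* For distinct signs [peirceM] reverses products, so the identity is taken at [b], [a] and its two
   right-hand summands trade places. *)
case E: (s == t); [have := rb a b | have := rb b a];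
  move/(congr1 (fun z => peirce s t z k)); rewrite scale0r addr0 -linearD;
  case: k hk => [|[|[|[|//]]]] hk;
  rewrite peirceM // E [in RHS]peirce_lin // /mxapply /peirce_mul
    !peirceD !peirceM // E /peirce_mul !peirce_lin // /mxapply !unpeirceK //=;
  lra.
Qed.

Local Notation r s t k l := (peirce s t (P (hss_basis R (inord l))) k).

Lemma peirce_mxE s t k :
  [/\ peirce_mx s t k 0 = (r s t k 0 + sg t * r s t k 1) / 2,
      peirce_mx s t k 1 = (r s t k 0 - sg t * r s t k 1) / 2,
      peirce_mx s t k 2 = (r s t k 2 + sg s * r s t k 3) / 2 &
      peirce_mx s t k 3 = (r s t k 2 - sg s * r s t k 3) / 2].
Proof.
rewrite /peirce_mx /unpeirce /=.
by case: k => [|[|[|k]]]; 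
  rewrite /peirce !coord_lin !hss_coord_mk ?hss_coord_basis_nat //=;
  split; field.
Qed.

Lemma coord_peirce s t x :
  [/\ x@0 = (peirce s t x 0 + peirce s t x 1) / 2,
      x@1 = sg t * (peirce s t x 0 - peirce s t x 1) / 2,
      x@2 = (peirce s t x 2 + peirce s t x 3) / 2 &
      x@3 = sg s * (peirce s t x 2 - peirce s t x 3) / 2].
Proof.
by rewrite /peirce; case: s t => [] []; rewrite ?expr0 ?expr1; split; field.
Qed.

(** In the basis of signs [s], [t], P e_0 = P f + P g = 0, and P v = 0 ties column 3 to column 2. As
    e_1 = [sg t] (f - g) and e_2 = u + v, columns 1 and 2 are multiples of P f and P u, hence
    proportional. The image has no g component, so row 0 determines row 1. *)
Lemma rank_one_entries (s t : bool) : rota_baxter 0 P -> peirce_mx s t 0 2 != 0 ->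
  [/\ forall k, (k < 4)%N -> p k 0 = 0 /\ p k 3 = sg s * p k 2,
      p 1 1 = sg t * p 0 1 /\ p 1 2 = sg t * p 0 2,
      p 2 2 + sg s * p 3 2 = - sg t * p 0 1,
      p 0 2 * p 2 1 = p 0 1 * p 2 2 /\ p 0 2 * p 3 1 = p 0 1 * p 3 2 &
      p 0 2 != 0].
Proof.
move=> rb nz.
have [q12 q10 q00 q31 q0] := peirce_rank_one (peirce_rb _ _ rb) nz.
have sgK b (z : R) : sg b * (sg b * z) = z.
  by rewrite mulrA -expr2 sqrr_sign mul1r.
have sgI b : injective (fun z : R => sg b * z) by apply: (can_inj (sgK b)).
have r0 k : (k < 4)%N -> r s t k 0 = 0.
  by move=> hk; have [] := q31 k hk; have [-> -> _ _] := peirce_mxE s t k; lra.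
have r3 k : (k < 4)%N -> r s t k 3 = sg s * r s t k 2.
  move=> hk; apply: (sgI s); rewrite sgK.
  by have [] := q31 k hk; have [_ _ _ ->] := peirce_mxE s t k; lra.
have q2 k : (k < 4)%N -> peirce_mx s t k 2 = r s t k 2.
  by move=> hk; have [_ _ -> _] := peirce_mxE s t k; rewrite r3 // sgK; field.
have q1 k : (k < 4)%N -> peirce_mx s t k 0 = sg t * r s t k 1 / 2.
  by move=> hk; have [-> _ _ _] := peirce_mxE s t k; rewrite r0 // add0r.
have r11 : r s t 1 1 = 0 by apply: (sgI t); move: q10; rewrite q1 //; lra.
have r12 : r s t 1 2 = 0 by rewrite -q2.
have r22 : r s t 2 2 = - sg t * r s t 0 1 / 2.
  by rewrite -q2 //; move: q00; rewrite q1 //; lra.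
have r1 k : (k < 4)%N -> r s t 0 2 * r s t k 1 = r s t 0 1 * r s t k 2.
  move=> hk; apply: (sgI t); move: (q0 k hk).
  by rewrite q1 // !q2 // r22; lra.
have {}nz : r s t 0 2 != 0 by rewrite -q2.
have [p00 p10 p20 p30] := coord_peirce s t (P (hss_basis R (inord 0))).
have [p01 p11 p21 p31] := coord_peirce s t (P (hss_basis R (inord 1))).
have [p02 p12 p22 p32] := coord_peirce s t (P (hss_basis R (inord 2))).
have [p03 p13 p23 p33] := coord_peirce s t (P (hss_basis R (inord 3))).
have r12' := r1 2%N isT; have r13' := r1 3%N isT.
rewrite /entry; split.
- move=> [|[|[|[|//]]]] _; rewrite ?(p00, p10, p20, p30) ?r0 //;
    rewrite ?(addr0, subr0, mulr0, mul0r); split=> //;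
    rewrite ?(p03, p13, p23, p33, p02, p12, p22, p32) !r3 //; ring.
- by rewrite p01 p02 p11 p12 r11 r12; split; ring.
- rewrite p01 r11 addr0 mulrA -r22.
  by rewrite p22 p32 mulrA sgK; field.
- rewrite p01 p02 p21 p22 p31 p32 r11 r12.
  split; first lra.
  (* Coordinates along e_3 carry the factor [sg s]; scaling both relations by it makes the goal a
     linear consequence. *)
  by move/(congr1 ( *%R (sg s))): r12'; move/(congr1 ( *%R (sg s))): r13'; lra.
- by rewrite p02 r12 addr0 mulf_neq0 // invr_eq0 pnatr_eq0.
Qed.

(** The alternatives are: P kills N, the image lies in the line of u, or it lies in the line of
    v. *)
Lemma nilpotent_entries : rota_baxter 0 P ->
  p 0 2 = 0 -> p 1 2 = 0 -> p 0 3 = 0 -> p 1 3 = 0 ->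
  [/\ forall k l, (k < 2)%N -> (l < 4)%N -> p k l = 0,
      p 3 3 = - p 2 2, p 3 2 = - p 2 3 &
  [\/ p 2 2 = 0 /\ p 2 3 = 0,
      [/\ p 2 3 = - p 2 2, p 3 0 = p 2 0 & p 3 1 = p 2 1] |
      [/\ p 2 3 = p 2 2, p 3 0 = - p 2 0 & p 3 1 = - p 2 1]]].
Proof.
move=> rb p02 p12 p03 p13; have := peirce_nilpotent (peirce_rb false false rb).
have [-> -> -> ->] := peirce_mxE false false 0.
have [-> -> -> ->] := peirce_mxE false false 1.
have [-> -> -> ->] := peirce_mxE false false 2.
have [-> -> -> ->] := peirce_mxE false false 3.
rewrite /peirce -!/(entry _ _) expr0 !mul1r p02 p12 p03 p13.
rewrite !(addr0, subrr, mul0r).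
move=> /(_ erefl erefl erefl erefl).
move=> [[q00 q10 q01 q11] q22 q33 q23_32 [q23 q32]].
have p00 : p 0 0 = 0 by lra.
have p10 : p 1 0 = 0 by lra.
have p01 : p 0 1 = 0 by lra.
have p11 : p 1 1 = 0 by lra.
split; [|lra|lra|].
  by move=> [|[|//]] [|[|[|[|//]]]].
(* Given the relations above, the Peirce entries [q 2 3] and [q 3 2] equal [p 2 2 - p 2 3] and
   [p 2 2 + p 2 3]. *)
have [n23 | n23] := eqVneq (p 2 3) (p 2 2).
  have [n22 | n22] := eqVneq (p 2 2) 0; first by constructor 1; lra.
  constructor 3; have [] := q32; last by split; lra.
  by apply: contraNneq n22; lra.
have n22 : p 2 3 = - p 2 2 by case: q23_32 => ?; lra.
constructor 2; have [] := q23; last by split; lra.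
by apply: contraNneq n23; lra.
Qed.

(** * Sufficient conditions on the entries *)

Lemma rota_baxter0P :
  (forall x y k, (k < 4)%N -> (P x * P y)@k = (P (P x * y) + P (x * P y))@k) ->
  rota_baxter 0 P.
Proof.
by move=> rb x y; rewrite scale0r addr0; apply: hss_eqP => k; apply: rb.
Qed.

(** Here [lambda] is not a weight but the ratio of column 1 to column 2, so that one statement
    covers rank-one matrices with or without a zero column 1. *)
Lemma rank_one_rota_baxter (s t : bool) (lambda : R) :
  (forall k, (k < 4)%N ->
    [/\ p k 0 = 0, p k 1 = lambda * p k 2 & p k 3 = sg s * p k 2]) ->
  p 1 2 = sg t * p 0 2 ->
  p 3 2 = - sg s * (sg t * lambda * p 0 2 + p 2 2) ->
  rota_baxter 0 P.
Proof.
move=> hp p12 p32; apply: rota_baxter0P => x y k hk.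
have [[p00 p01 p03] [p10 p11 p13]] := (hp 0%N isT, hp 1%N isT).
have [[p20 p21 p23] [p30 p31 p33]] := (hp 2%N isT, hp 3%N isT).
move: k hk => [|[|[|[|//]]]] _; rewrite !coordE;
  rewrite p00 p01 p03 p10 p11 p13 p20 p21 p23 p30 p31 p33 p12 p32;
  case: s t {hp p12 p32 p00 p01 p03 p10 p11 p13 p20 p21 p23 p30 p31 p33} => [] [];
  rewrite ?expr0 ?expr1; ring.
Qed.

(** The image lies in the square-zero ideal N, which P kills, so every term of the identity
    vanishes. *)
Lemma nilpotent_rota_baxter :
  (forall k l, (k < 4)%N -> (l < 4)%N -> (k < 2)%N || (1 < l)%N -> p k l = 0) ->
  rota_baxter 0 P.
Proof.
move=> hp; apply: rota_baxter0P => x y k hk.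
by move: k hk => [|[|[|[|//]]]] _; rewrite !coordE;
  rewrite !(hp 0%N) // !(hp 1%N) // !(hp _ 2%N) // !(hp _ 3%N) //; ring.
Qed.

(** The same argument with N replaced by the line of e_2 + [sg s] e_3, also a two-sided ideal of
    square zero: it contains the image and is killed by P. *)
Lemma nilpotent_line_rota_baxter (s : bool) :
  (forall k l, (k < 2)%N -> (l < 4)%N -> p k l = 0) ->
  p 2 3 = - sg s * p 2 2 -> (forall l, (l < 4)%N -> p 3 l = sg s * p 2 l) ->
  rota_baxter 0 P.
Proof.
move=> hp p23 p3; apply: rota_baxter0P => x y k hk.
by move: k hk => [|[|[|[|//]]]] _; rewrite !coordE;
  rewrite !(hp 0%N) // !(hp 1%N) // !p3 // p23; case: s {p23 p3};
  rewrite ?expr0 ?expr1; ring.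
Qed.
End Coordinates.

(** * Matching the entry conditions with the eleven families *)

Theorem theorem4p1 (R : realType) (P : {linear hss R -> hss R})
    (M : 'M[R]_4) (hM : hss_matrix P = M) :
  rota_baxter 0 P <->
    (exists a b c d : R,
      M = mx4 [:: [:: 0; 0; 0; 0];
                  [:: 0; 0; 0; 0];
                  [:: a; b; 0; 0];
                  [:: c; d; 0; 0]]) \/
    (exists a b c : R,
      M = mx4 [:: [:: 0; 0; 0; 0];
                  [:: 0; 0; 0; 0];
                  [:: a; b; c; - c];
                  [:: a; b; c; - c]]) \/
    (exists a b c : R,
      M = mx4 [:: [:: 0; 0; 0; 0];
                  [:: 0; 0; 0; 0];
                  [:: a; b; c; c];
                  [:: - a; - b; - c; - c]]) \/
    (exists a b : R,
      M = mx4 [:: [:: 0; 0; a; - a];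
                  [:: 0; 0; - a; a];
                  [:: 0; 0; b; - b];
                  [:: 0; 0; b; - b]]) \/
    (exists a b : R,
      M = mx4 [:: [:: 0; 0; a; - a];
                  [:: 0; 0; a; - a];
                  [:: 0; 0; b; - b];
                  [:: 0; 0; b; - b]]) \/
    (exists a b : R,
      M = mx4 [:: [:: 0; 0; a; a];
                  [:: 0; 0; - a; - a];
                  [:: 0; 0; b; b];
                  [:: 0; 0; - b; - b]]) \/
    (exists a b : R,
      M = mx4 [:: [:: 0; 0; a; a];
                  [:: 0; 0; a; a];
                  [:: 0; 0; b; b];
                  [:: 0; 0; - b; - b]]) \/
    (exists a b c : R, a != 0 /\ b != 0 /\
      M = mx4 [:: [:: 0; a; b; - b];
                  [:: 0; - a; - b; b];
                  [:: 0; c; b * c / a; - (b * c / a)];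
                  [:: 0; c - a ^+ 2 / b; b * c / a - a; a - b * c / a]]) \/
    (exists a b c : R, a != 0 /\ b != 0 /\
      M = mx4 [:: [:: 0; a; b; - b];
                  [:: 0; a; b; - b];
                  [:: 0; c; b * c / a; - (b * c / a)];
                  [:: 0; a ^+ 2 / b + c; b * c / a + a;
                      - ((a ^+ 2 + b * c) / a)]]) \/
    (exists a b c : R, a != 0 /\ b != 0 /\
      M = mx4 [:: [:: 0; a; b; b];
                  [:: 0; - a; - b; - b];
                  [:: 0; c; b * c / a; b * c / a];
                  [:: 0; a ^+ 2 / b - c; a - b * c / a; a - b * c / a]]) \/
    (exists a b c : R, a != 0 /\ b != 0 /\
      M = mx4 [:: [:: 0; a; b; b];
                  [:: 0; a; b; b];
                  [:: 0; c; b * c / a; b * c / a];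
                  [:: 0; - ((a ^+ 2 + b * c) / b); - ((a ^+ 2 + b * c) / a);
                      - ((a ^+ 2 + b * c) / a)]]).
Proof.
rewrite -{}hM; split=> [rb | ].
  (* Over the four sign pairs, [peirce_mx P s t 0 2] runs through the f and g components of P u and
     P v. These are independent combinations of the entries in rows 0, 1 and columns 2, 3, so if all
     vanish, so do those entries. *)
  have [/forallP z | /forallPn[[s t] /= nz]] :=
    boolP [forall st : bool * bool, peirce_mx P st.1 st.2 0 2 == 0].
    have {}z s t : peirce_mx P s t 0 2 = 0 by apply/eqP/(z (s, t)).
    move: (z false false) (z false true) (z true false) (z true true).
    have q02 s t := let: And4 _ _ h _ := peirce_mxE P s t 0 in h.
    rewrite !q02 /peirce -!/(entry P _ _) expr0 expr1 => z1 z2 z3 z4 {z q02}.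
    have p02 : entry P 0 2 = 0 by lra.
    have p12 : entry P 1 2 = 0 by lra.
    have p03 : entry P 0 3 = 0 by lra.
    have p13 : entry P 1 3 = 0 by lra.
    have [p01 p33 p32 ca] := nilpotent_entries rb p02 p12 p03 p13.
    case: ca => [[p22 p23] | [p23 p30 p31] | [p23 p30 p31]].
    - left; exists (entry P 2 0), (entry P 2 1), (entry P 3 0), (entry P 3 1).
      apply/hss_matrix_mx4 => -[|[|[|[|//]]]] [|[|[|[|//]]]] _ _ //=;
        by rewrite ?(p01 0%N) ?(p01 1%N) // ?p33 ?p32 ?p22 ?p23 ?oppr0.
    - right; left; exists (entry P 2 0), (entry P 2 1), (entry P 2 2).
      apply/hss_matrix_mx4 => -[|[|[|[|//]]]] [|[|[|[|//]]]] _ _ //=;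
        by rewrite ?(p01 0%N) ?(p01 1%N) // ?p33 ?p32 ?p23 ?opprK.
    - do 2 right; left; exists (entry P 2 0), (entry P 2 1), (entry P 2 2).
      apply/hss_matrix_mx4 => -[|[|[|[|//]]]] [|[|[|[|//]]]] _ _ //=;
        by rewrite ?(p01 0%N) ?(p01 1%N) // ?p33 ?p32 ?p23 ?opprK.
  have [p03 [p11 p12] p22 [p21 p31] p02] := rank_one_entries rb nz.
  have p0 k hk := (p03 k hk).1; have {p03} p3 k hk := (p03 k hk).2.
  have p32 : entry P 3 2 = - (-1) ^+ s * ((-1) ^+ t * entry P 0 1 + entry P 2 2).
    by case: s p22 {p3 nz}; rewrite ?expr0 ?expr1; lra.
  do 3 right.
  (* Column 1 is [entry P 0 1 / entry P 0 2] times column 2: it vanishes in the two-parameter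
     families, while in the others both entries may be inverted. *)
  have [p01 | p01] := eqVneq (entry P 0 1) 0.
    have {}p21 : entry P 2 1 = 0 by apply: (mulfI p02); rewrite p21 p01 mul0r mulr0.
    have {}p31 : entry P 3 1 = 0 by apply: (mulfI p02); rewrite p31 p01 mul0r mulr0.
    rewrite p01 mulr0 in p11; rewrite p01 mulr0 add0r in p32.
    set a := entry P 0 2 in p02 p12 *; set b := entry P 2 2 in p32 *.
    have E k l : (k < 4)%N -> (l < 4)%N -> entry P k l =
      (nth [::] [:: [:: 0; 0; a; (-1) ^+ s * a];
        [:: 0; 0; (-1) ^+ t * a; (-1) ^+ s * ((-1) ^+ t * a)];
        [:: 0; 0; b; (-1) ^+ s * b];
        [:: 0; 0; - (-1) ^+ s * b; - b]] k)`_l.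
      move: k l => [|[|[|[|//]]]] [|[|[|[|//]]]] _ _ /=;
        rewrite ?p0 // ?p3 // ?(p01, p11, p21, p31, p12, p32) //.
      by rewrite mulNr mulrN mulrA -expr2 sqrr_sign mul1r.
    (* Here and below [true] stands for the sign -1, and the sign pairs come in the order of the
       families. *)
    case: s t {p3 p11 p12 p32 nz p22} E => [] [];
      rewrite ?(expr0, expr1, mul1r, mulN1r, opprK) => E;
      [left | right; left | do 2 right; left | do 3 right; left];
      by exists a, b; apply/hss_matrix_mx4.
  do 4 right.
  have {}p21 : entry P 2 2 = entry P 0 2 * entry P 2 1 / entry P 0 1.
    by rewrite p21; field.
  have {}p31 : entry P 3 1 = entry P 0 1 * entry P 3 2 / entry P 0 2.
    by rewrite -p31; field.
  case: s t {nz p22} p3 p11 p12 p32 => [] []; rewrite ?expr0 ?expr1 => p3 p11 p12 p32;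
    [left | right; left | do 2 right; left | do 3 right];
    exists (entry P 0 1), (entry P 0 2), (entry P 2 1); do 2 split=> //;
    apply/hss_matrix_mx4 => -[|[|[|[|//]]]] [|[|[|[|//]]]] _ _ /=;
    rewrite ?p0 // ?p3 // ?p31 ?p12 ?p11 ?p32 ?p21;
    by field; rewrite ?p01 ?p02.
(* The ratio [lambda] will be [0] for the two-parameter families and [a / b], read off row 0, for
   the three-parameter ones. *)
have rank_one (s t : bool) lambda rows : hss_matrix P = mx4 rows ->
    (forall k, (k < 4)%N -> [/\ (nth [::] rows k)`_0 = 0,
      (nth [::] rows k)`_1 = lambda * (nth [::] rows k)`_2 &
      (nth [::] rows k)`_3 = (-1) ^+ s * (nth [::] rows k)`_2]) ->
    (nth [::] rows 1)`_2 = (-1) ^+ t * (nth [::] rows 0)`_2 ->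
    (nth [::] rows 3)`_2 = - (-1) ^+ s *
      ((-1) ^+ t * lambda * (nth [::] rows 0)`_2 + (nth [::] rows 2)`_2) ->
    rota_baxter 0 P.
  move/hss_matrix_mx4 => E h h1 h3; apply: (@rank_one_rota_baxter _ _ s t lambda).
  - by move=> k hk; rewrite !E //; apply: h.
  - by rewrite !E.
  - by rewrite !E.
case=> [[a [b [c [d /hss_matrix_mx4 E]]]] | ].
  apply: nilpotent_rota_baxter => k l hk hl; rewrite E //.
  by move: k l hk hl => [|[|[|[|//]]]] [|[|[|[|//]]]].
case=> [[a [b [c /hss_matrix_mx4 E]]] | ].
  apply: (@nilpotent_line_rota_baxter _ _ false); last 1 first.
  - by move=> [|[|[|[|//]]]] hl; rewrite !E //= expr0 mul1r.
  - by move=> [|[|//]] [|[|[|[|//]]]] _ _; rewrite E.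
  - by rewrite !E //= expr0 mulN1r.
case=> [[a [b [c /hss_matrix_mx4 E]]] | ].
  apply: (@nilpotent_line_rota_baxter _ _ true); last 1 first.
  - by move=> [|[|[|[|//]]]] hl; rewrite !E //= expr1 mulN1r.
  - by move=> [|[|//]] [|[|[|[|//]]]] _ _; rewrite E.
  - by rewrite !E //= expr1 opprK mul1r.
have sgE := (expr0 (-1 : R), expr1 (-1 : R)).
case=> [[a [b E]] | ].
  apply: (rank_one true true 0 _ E) => [[|[|[|[|//]]]] _ | | ];
    rewrite /= ?sgE; by do ?split; ring.
case=> [[a [b E]] | ].
  apply: (rank_one true false 0 _ E) => [[|[|[|[|//]]]] _ | | ];
    rewrite /= ?sgE; by do ?split; ring.
case=> [[a [b E]] | ].
  apply: (rank_one false true 0 _ E) => [[|[|[|[|//]]]] _ | | ];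
    rewrite /= ?sgE; by do ?split; ring.
case=> [[a [b E]] | ].
  apply: (rank_one false false 0 _ E) => [[|[|[|[|//]]]] _ | | ];
    rewrite /= ?sgE; by do ?split; ring.
case=> [[a [b [c [a0 [b0 E]]]]] | ].
  apply: (rank_one true true (a / b) _ E) => [[|[|[|[|//]]]] _ | | ];
    rewrite /= ?sgE; by do ?split; field; rewrite ?a0 ?b0.
case=> [[a [b [c [a0 [b0 E]]]]] | ].
  apply: (rank_one true false (a / b) _ E) => [[|[|[|[|//]]]] _ | | ];
    rewrite /= ?sgE; by do ?split; field; rewrite ?a0 ?b0.
case=> [[a [b [c [a0 [b0 E]]]]] | ].
  apply: (rank_one false true (a / b) _ E) => [[|[|[|[|//]]]] _ | | ];
    rewrite /= ?sgE; by do ?split; field; rewrite ?a0 ?b0.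
move=> [a [b [c [a0 [b0 E]]]]].
apply: (rank_one false false (a / b) _ E) => [[|[|[|[|//]]]] _ | | ];
  rewrite /= ?sgE; by do ?split; field; rewrite ?a0 ?b0.
Qed.
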